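(* If $A$ and $B$ are both $4\times 4$ Hadamard matrices in dephased form, and $\operatorname{tr}(A)=\operatorname{tr}(B)$, then $A$ and $B$ are spectrally equivalent.
   Context: An $n\times n$ complex matrix $H$ is called a Hadamard matrix if it is unitary ($HH^*=H^*H=I_n$) and all its entries have complex modulus $\frac{1}{\sqrt n}$. A Hadamard matrix is in dephased form if all entries of its first row and of its first column are equal to $\frac{1}{\sqrt n}$. Two matrices are spectrally equivalent if their spectra are equal including multiplicity (for the unitary matrices considered here, equivalently $A=U^*BU$ for some unitary $U$). *)

(* Defs.v *)
From mathcomp Require Import all_boot all_order all_algebra.
From mathcomp Require Import reals.
From mathcomp Require Import complex.

Set Implicit Arguments.
Unset Strict Implicit.
Unset Printing Implicit Defensive.

Import Order.TTheory GRing.Theory Num.Theory.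
Local Open Scope ring_scope.

(* R[i], for R : realType, is the field of complex numbers. The library's
   unitarymx asks only for H H^* = I; for square H, H^* H = I follows
   (mulmx1C). *)
Definition hadamard (R : realType) (n : nat) (H : 'M[R[i]]_n) : Prop :=
  H \is unitarymx /\ forall i j, `|H i j| = (sqrtC n%:R)^-1.

Definition dephased (R : realType) (n : nat) (H : 'M[R[i]]_n) : Prop :=
  forall i j : 'I_n, (i = 0%N :> nat) \/ (j = 0%N :> nat) ->
    H i j = (sqrtC n%:R)^-1.

(* The spectrum with multiplicity is encoded as the function sending z to its
   algebraic multiplicity as an eigenvalue of A (0 off the spectrum). *)
Definition spectrum_mult (R : realType) (n : nat) (A : 'M[R[i]]_n) (z : R[i])
  : nat := mup z (char_poly A).

Definition spectrally_equivalent (R : realType) (n : nat)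
    (A B : 'M[R[i]]_n) : Prop :=
  forall z : R[i], spectrum_mult A z = spectrum_mult B z.

(* Main.v *)
(** On a dephased Hadamard matrix [A] the plane spanned by the first basis
    vector and the all-ones vector is invariant with eigenvalues 1 and -1, so
    the characteristic polynomial is [(X^2 - 1) (X^2 - T X + D)] with [T] the
    trace and [D = - det A].  Unitarity, in the form [adj A = det A . A^*],
    gives [T = D . conj T], which determines [D] when [T <> 0].  When [T = 0],
    the diagonal entries below the first sum to -1/2 and have modulus 1/2, so
    one of them is -1/2; vanishing row and column sums and strict convexity of
    the disc then fix all other entries up to a sign, and [D = -1]. *)
Require Import Defs.
From mathcomp Require Import all_boot all_order all_algebra.
From mathcomp Require Import reals.
From mathcomp Require Import complex.
From mathcomp Require Import ring.

Import Order.TTheory GRing.Theory Num.Theory.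
Local Open Scope ring_scope.

(** * Explicit determinants and cofactors in sizes 3 and 4 *)

Lemma det_mx33 (F : comNzRingType) (f : nat -> nat -> F) :
  \det (\matrix_(i < 3, j < 3) f i j) =
    f 0 0 * (f 1 1 * f 2 2 - f 1 2 * f 2 1)
    - f 0 1 * (f 1 0 * f 2 2 - f 1 2 * f 2 0)
    + f 0 2 * (f 1 0 * f 2 1 - f 1 1 * f 2 0).
Proof.
rewrite (expand_det_row _ ord0) !big_ord_recl big_ord0 /cofactor.
rewrite !(expand_det_row _ ord0) !big_ord_recl !big_ord0 /cofactor !det_mx11.
rewrite !mxE /= /bump /=.
ring.
Qed.

(** With entries indexed by [nat], the shifts [bump] compute to literal indices, which lets [ring]
    close the expansions below. *)
Lemma cofactor_mx44 (F : comNzRingType) (f : nat -> nat -> F) (i j : 'I_4)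
    (g := fun k l => f (bump i k) (bump j l)) :
  cofactor (\matrix_(i < 4, j < 4) f i j) i j = (-1) ^+ (i + j) *
    (g 0 0 * (g 1 1 * g 2 2 - g 1 2 * g 2 1)
     - g 0 1 * (g 1 0 * g 2 2 - g 1 2 * g 2 0)
     + g 0 2 * (g 1 0 * g 2 1 - g 1 1 * g 2 0)).
Proof.
rewrite /cofactor -det_mx33; congr (_ * \det _).
by apply/matrixP => k l; rewrite !mxE.
Qed.

(* [h] stands for 1/2: kept symbolic, it makes the identities homogeneous, hence
   valid over any commutative ring. *)
Section DephasedRing.

Variables (F : comNzRingType) (h : F) (f : nat -> nat -> F).

(** Sum of the principal 2x2 minors of the lower right 3x3 block. *)
Definition core_minors : F :=
  f 1 1 * f 2 2 - f 1 2 * f 2 1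
  + (f 1 1 * f 3 3 - f 1 3 * f 3 1)
  + (f 2 2 * f 3 3 - f 2 3 * f 3 2).

Definition border_trace : F := h + f 1 1 + f 2 2 + f 3 3.

Hypothesis f0j : forall j, (j < 4)%N -> f 0 j = h.
Hypothesis fi0 : forall i, (i < 4)%N -> f i 0 = h.
Hypothesis row_sum :
  forall i, (0 < i < 4)%N -> h + f i 1 + f i 2 + f i 3 = 0.
Hypothesis col_sum :
  forall j, (0 < j < 4)%N -> h + f 1 j + f 2 j + f 3 j = 0.

(** Eliminating the last row and column leaves polynomial identities in [h] and four free
    entries. *)
Let f13 : f 1 3 = - (h + f 1 1 + f 1 2).
Proof. by apply/eqP; rewrite -addr_eq0 addrC row_sum. Qed.
Let f23 : f 2 3 = - (h + f 2 1 + f 2 2).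
Proof. by apply/eqP; rewrite -addr_eq0 addrC row_sum. Qed.
Let f31 : f 3 1 = - (h + f 1 1 + f 2 1).
Proof. by apply/eqP; rewrite -addr_eq0 addrC col_sum. Qed.
Let f32 : f 3 2 = - (h + f 1 2 + f 2 2).
Proof. by apply/eqP; rewrite -addr_eq0 addrC col_sum. Qed.
Let f33 : f 3 3 = h + f 1 1 + f 1 2 + f 2 1 + f 2 2.
Proof.
have /eqP := row_sum 3 isT; rewrite addrC addr_eq0 => /eqP ->.
by rewrite f31 f32; ring.
Qed.

Lemma dephased_trace : \tr (\matrix_(i < 4, j < 4) f i j) = border_trace.
Proof.
rewrite /mxtrace !big_ord_recl big_ord0 !mxE /= /bump /= f0j // /border_trace.
ring.
Qed.

Lemma dephased_char_poly :
  char_poly (\matrix_(i < 4, j < 4) f i j) =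
    ('X^2 - (4 * h ^+ 2)%:P) *
    ('X^2 - border_trace%:P * 'X + (h * border_trace + core_minors)%:P).
Proof.
rewrite /char_poly.
set g := fun i j : nat => 'X *+ (i == j) - (f i j)%:P.
have -> : char_poly_mx (\matrix_(i < 4, j < 4) f i j)
          = \matrix_(i < 4, j < 4) g i j.
  by apply/matrixP => i j; rewrite !mxE.
rewrite (expand_det_row _ ord0) !big_ord_recl big_ord0 !cofactor_mx44 !mxE.
rewrite /g /= /bump /= !fi0 // !f0j // /border_trace /core_minors.
rewrite f13 f23 f31 f32 f33.
rewrite !(rmorphD, rmorphB, rmorphN, rmorphM, rmorphXn, rmorph_nat) /=.
ring.
Qed.

Lemma dephased_det :
  \det (\matrix_(i < 4, j < 4) f i j) =
    - (4 * h ^+ 2) * (h * border_trace + core_minors).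
Proof.
rewrite (expand_det_row _ ord0) !big_ord_recl big_ord0 !cofactor_mx44 !mxE.
rewrite /= /bump /= !fi0 // !f0j // /border_trace /core_minors.
rewrite f13 f23 f31 f32 f33.
ring.
Qed.

(** This is the third elementary symmetric function of the eigenvalues; comparing it with the trace
    of the conjugate transpose relates [T] and [D]. *)
Lemma dephased_trace_adj :
  \tr (\adj (\matrix_(i < 4, j < 4) f i j)) = - (4 * h ^+ 2) * border_trace.
Proof.
rewrite /mxtrace !big_ord_recl big_ord0 4!mxE !cofactor_mx44.
rewrite /= /bump /= !fi0 // !f0j // /border_trace.
rewrite f13 f23 f31 f32 f33.
ring.
Qed.

End DephasedRing.

(** * Sums of complex numbers of equal modulus *)

Section Modulus.

Variables (C : numClosedFieldType) (h : C).
Hypothesis h_gt0 : 0 < h.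

(** By the parallelogram identity, |p - q|^2 = 2|p|^2 + 2|q|^2 - |p + q|^2 = 4h^2 - 4h^2. *)
Lemma eq_of_mean_norm (p q b : C) :
  `|p| = h -> `|q| = h -> `|b| = h -> p + q = - (b *+ 2) ->
  p = - b /\ q = - b.
Proof.
move=> np nq nb pqb.
have E x : `|x| = h -> x * x^* = h ^+ 2 by move=> <-; rewrite normCK.
have : (p + q) * (p + q)^* = 4 * h ^+ 2.
  by rewrite pqb rmorphN rmorphMn /= -(E b nb); ring.
rewrite rmorphD /= => S.
have : (p - q) * (p - q)^* = 0.
  rewrite rmorphB /=.
  transitivity (2 * (p * p^*) + 2 * (q * q^*) - (p + q) * (p^* + q^*)).
    by ring.
  by rewrite S !E //; ring.
move=> /eqP; rewrite mul_conjC_eq0 subr_eq0 => /eqP epq; rewrite -epq.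
suff -> : p = - b by [].
have : p *+ 2 = (- b) *+ 2 by rewrite mulNrn -pqb -epq mulr2n.
by move/eqP; rewrite -subr_eq0 -mulrnBl mulrn_eq0 subr_eq0 => /eqP.
Qed.

(** Conjugating the zero sum turns each x into h^2/x, so the third elementary symmetric function of
    h, a, b, c vanishes along with the first. Hence (a + h)(b + h)(c + h) = 0. *)
Lemma eq_opp_of_sum_opp (a b c : C) :
  `|a| = h -> `|b| = h -> `|c| = h -> h + a + b + c = 0 ->
  [|| a == - h, b == - h | c == - h].
Proof.
move=> na nb nc s0.
have E x : `|x| = h -> x * x^* = h ^+ 2 by move=> <-; rewrite normCK.
have hc : h^* = h by apply/CrealP; rewrite ger0_real // ltW.
have s0' : h + a^* + b^* + c^* = 0 by rewrite -{1}hc -!rmorphD s0 rmorph0.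
have : h * ((a + h) * (b + h) * (c + h)) = 0.
  transitivity (a * b * c * (h + a^* + b^* + c^*)
    + (h ^+ 2 - a * a^*) * (b * c) + (h ^+ 2 - b * b^*) * (a * c)
    + (h ^+ 2 - c * c^*) * (a * b) + h ^+ 3 * (h + a + b + c)).
    by ring.
  by rewrite s0 s0' !E // !subrr; ring.
move/eqP; rewrite mulf_eq0 gt_eqF //= !mulf_eq0 !addr_eq0.
by rewrite -orbA.
Qed.

(* The variables are the lower right block [a p p'; q b r; q' s c], arranged
   symmetrically so that any diagonal entry can be moved to the place of [a]. *)
Lemma core_minors_special (a b c p p' q q' r s : C) :
  `|p| = h -> `|q| = h -> `|b| = h -> a = - h ->
  h + a + b + c = 0 ->
  h + a + p + p' = 0 -> h + q + b + r = 0 -> h + q' + s + c = 0 ->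
  h + a + q + q' = 0 -> h + p + b + s = 0 -> h + p' + r + c = 0 ->
  h * h^* + a * q^* + p * b^* + p' * r^* = 0 ->
  a * b - p * q + (a * c - p' * q') + (b * c - r * s) = - (4 * h ^+ 2).
Proof.
move=> np nq nb -> t0 r1 r2 r3 c1 c2 c3 o12.
have hc : h^* = h by apply/CrealP; rewrite ger0_real // ltW.
have ec : c = - b by apply/eqP; rewrite -addr_eq0 -t0; apply/eqP; ring.
have ep' : p' = - p by apply/eqP; rewrite -addr_eq0 -r1; apply/eqP; ring.
have eq' : q' = - q by apply/eqP; rewrite -addr_eq0 -c1; apply/eqP; ring.
have er : r = - (h + q + b).
  by apply/eqP; rewrite -addr_eq0 -r2; apply/eqP; ring.
have es : s = - (h + p + b).
  by apply/eqP; rewrite -addr_eq0 -c2; apply/eqP; ring.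
have pq : p + q = - (b *+ 2).
  apply/eqP; rewrite -addr_eq0 -[X in _ == X]oppr0 -c3 ep' er ec.
  by apply/eqP; ring.
have [ep eq] := eq_of_mean_norm _ _ _ np nq nb pq.
have nbb : b * b^* = h ^+ 2 by rewrite -nb normCK.
have er' : r = - h by rewrite er eq; ring.
(* All entries are now [h] or [b] up to sign, and orthogonality reads h^2 - |b|^2 + h(b^* - b) = 0,
   so [b] is real. *)
have ebc : b^* = b.
  apply/eqP; rewrite -subr_eq0 -(mulrI_eq0 _ (lregP (lt0r_neq0 h_gt0))).
  rewrite -o12 ep' er' eq ep !rmorphN /= hc; apply/eqP.
  transitivity (h ^+ 2 - b * b^* + h * (b^* - b)); last by ring.
  by rewrite nbb; ring.
have b2 : b ^+ 2 = h ^+ 2 by rewrite -nbb ebc.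
rewrite es ec ep' eq' er' eq ep.
transitivity (- h ^+ 2 - 3 * b ^+ 2); first by ring.
by rewrite b2; ring.
Qed.

Lemma core_minors_trace0 (f : nat -> nat -> C) :
  (forall i j, (i < 4)%N -> (j < 4)%N -> `|f i j| = h) ->
  (forall i, (0 < i < 4)%N -> h + f i 1%N + f i 2%N + f i 3%N = 0) ->
  (forall j, (0 < j < 4)%N -> h + f 1%N j + f 2%N j + f 3%N j = 0) ->
  (forall i j, (0 < i < 4)%N -> (0 < j < 4)%N -> i != j ->
    h * h^* + f i 1%N * (f j 1%N)^* + f i 2%N * (f j 2%N)^*
      + f i 3%N * (f j 3%N)^* = 0) ->
  border_trace _ h f = 0 -> core_minors _ f = - (4 * h ^+ 2).
Proof.
rewrite /border_trace /core_minors => nf rs cs orth t0.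
have r1 := rs 1%N isT; have r2 := rs 2%N isT; have r3 := rs 3%N isT.
have c1 := cs 1%N isT; have c2 := cs 2%N isT; have c3 := cs 3%N isT.
case/or3P: (eq_opp_of_sum_opp _ _ _ (nf 1%N 1%N isT isT) (nf 2%N 2%N isT isT)
  (nf 3%N 3%N isT isT) t0) => /eqP e.
- apply: core_minors_special e _ _ _ _ _ _ _ _ => //; try exact: nf.
  exact: (orth 1%N 2%N).
(* Swapping indices 1 and 2 in both rows and columns moves the entry -h to the place of [a] and
   preserves the sum of principal minors. The last case swaps 1 and 3. *)
- have /= := @core_minors_special (f 2 2) (f 1 1) (f 3 3) (f 2 1) (f 2 3)
    (f 1 2) (f 3 2) (f 1 3) (f 3 1) (nf 2 1 isT isT)%N (nf 1 2 isT isT)%N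
    (nf 1 1 isT isT)%N e.
  move=> H; rewrite -H; first ring.
  + by rewrite -t0; ring.
  + by rewrite -r2; ring.
  + by rewrite -r1; ring.
  + by rewrite -r3; ring.
  + by rewrite -c2; ring.
  + by rewrite -c1; ring.
  + by rewrite -c3; ring.
  + by rewrite -(orth 2%N 1%N isT isT isT); ring.
- have /= := @core_minors_special (f 3 3) (f 2 2) (f 1 1) (f 3 2) (f 3 1)
    (f 2 3) (f 1 3) (f 2 1) (f 1 2) (nf 3 2 isT isT)%N (nf 2 3 isT isT)%N
    (nf 2 2 isT isT)%N e.
  move=> H; rewrite -H; first ring.
  + by rewrite -t0; ring.
  + by rewrite -r3; ring.
  + by rewrite -r2; ring.
  + by rewrite -r1; ring.
  + by rewrite -c3; ring.
  + by rewrite -c2; ring.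
  + by rewrite -c1; ring.
  + by rewrite -(orth 3%N 2%N isT isT isT); ring.
Qed.

End Modulus.

(** * Dephased Hadamard matrices of order 4 *)

Lemma sqrtC4_inv (C : numClosedFieldType) : (sqrtC 4%:R)^-1 = 2^-1 :> C.
Proof. by rewrite (_ : 4%:R = 2 ^+ 2) ?sqrCK ?ler0n // -natrX. Qed.

Lemma hadamard_tr (R : realType) (n : nat) (H : 'M[R[i]]_n) :
  hadamard H -> hadamard H^T.
Proof. by case=> uH nH; split=> [|i j]; rewrite ?trmx_unitary ?mxE. Qed.

Lemma dephased_tr (R : realType) (n : nat) (H : 'M[R[i]]_n) :
  dephased H -> dephased H^T.
Proof. by move=> dH i j ij; rewrite mxE dH //; case: ij; [right|left]. Qed.

Lemma hadamard_orthogonal (R : realType) (n : nat) (H : 'M[R[i]]_n) :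
  hadamard H -> forall i j, \sum_k H i k * (H j k)^* = (i == j)%:R.
Proof.
move=> [/unitarymxP uH _] i j; have /matrixP/(_ i j) := uH.
by rewrite !mxE => <-; apply: eq_bigr => k _; rewrite !mxE.
Qed.

(** The row is orthogonal to the first one, which is a nonzero constant. *)
Lemma dephased_row_sum (R : realType) (H : 'M[R[i]]_4) :
  hadamard H -> dephased H -> forall i : 'I_4, i != 0 -> \sum_k H i k = 0.
Proof.
move=> hH dH i i0; have := hadamard_orthogonal _ _ _ hH i 0; rewrite (negPf i0).
under eq_bigr => k _ do rewrite (dH 0 k (or_introl erefl)).
rewrite -mulr_suml => /eqP; rewrite mulf_eq0 conjC_eq0 sqrtC4_inv.
by rewrite invr_eq0 pnatr_eq0 orbF => /eqP.
Qed.

Lemma hadamard_char_poly (R : realType) (H : 'M[R[i]]_4) :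
  hadamard H -> dephased H ->
  exists D : R[i],
    [/\ char_poly H = ('X^2 - 1) * ('X^2 - (\tr H)%:P * 'X + D%:P),
        D * (\tr H)^* = \tr H & \tr H = 0 -> D = -1].
Proof.
move=> hH dH; set h : R[i] := 2^-1.
have h4 : 4 * h ^+ 2 = 1 by rewrite /h; field.
have h_gt0 : 0 < h by rewrite invr_gt0 ltr0n.
pose f i j := H (inord i) (inord j).
have HE : H = \matrix_(i < 4, j < 4) f i j.
  by apply/matrixP => i j; rewrite mxE /f !inord_val.
have i0 : inord 0 = 0 :> 'I_4 by apply/val_inj; rewrite /= inordK.
have f0 j : f 0 j = h by rewrite /f dH ?sqrtC4_inv // i0; left.
have f_0 i : f i 0 = h by rewrite /f dH ?sqrtC4_inv // i0; right.
have nf i j : `|f i j| = h by rewrite /f hH.2 sqrtC4_inv.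
have sumE (g : 'I_4 -> R[i]) :
    \sum_k g k = g 0 + g (inord 1) + g (inord 2) + g (inord 3).
  rewrite !big_ord_recl big_ord0 addr0 !addrA.
  by do !congr (_ + g _); apply/val_inj; rewrite /= inordK.
have inord_neq i j : (i < 4)%N -> (j < 4)%N -> i != j ->
    inord i != inord j :> 'I_4.
  by move=> li lj; rewrite -val_eqE /= !inordK.
have rs i : (0 < i < 4)%N -> h + f i 1 + f i 2 + f i 3 = 0.
  case/andP=> i_gt0 li.
  have := dephased_row_sum _ _ hH dH (inord i).
  rewrite sumE -i0 -(f_0 i) => -> //.
  by apply: inord_neq; rewrite -?lt0n.
have cs j : (0 < j < 4)%N -> h + f 1 j + f 2 j + f 3 j = 0.
  case/andP=> j_gt0 lj.
  have := dephased_row_sum _ _ (hadamard_tr _ _ _ hH)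
    (dephased_tr _ _ _ dH) (inord j).
  rewrite sumE !mxE -i0 -(f0 j) => -> //.
  by apply: inord_neq; rewrite -?lt0n.
have orth i j : (0 < i < 4)%N -> (0 < j < 4)%N -> i != j ->
    h * h^* + f i 1 * (f j 1)^* + f i 2 * (f j 2)^* + f i 3 * (f j 3)^* = 0.
  case/andP=> _ li /andP[_ lj] ij.
  have := hadamard_orthogonal _ _ _ hH (inord i) (inord j).
  by rewrite sumE -i0 (negPf (inord_neq _ _ li lj ij)) -{1}(f_0 i) -(f_0 j).
have trE : \tr H = border_trace _ h f by rewrite [in LHS]HE (dephased_trace _ h).
exists (h * border_trace _ h f + core_minors _ f); split.
- have := dephased_char_poly _ h f (fun j _ => f0 j) (fun i _ => f_0 i) rs cs.
  by rewrite -HE h4 polyC1 -trE.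
- have detE : \det H = - (h * border_trace _ h f + core_minors _ f).
    by rewrite [in LHS]HE (dephased_det _ h) // h4 mulN1r.
  (* Multiply [\adj H *m H], the scalar matrix of [\det H], on the right by the inverse of [H].
     Taking traces then gives -T = -D T^*. *)
  have : \adj H = \det H *: (H ^t Num.conj)%sesqui.
    rewrite -mul_scalar_mx -mul_adj_mx -mulmxA.
    by move/unitarymxP: hH.1 => ->; rewrite mulmx1.
  move/(congr1 mxtrace); rewrite {1}HE (dephased_trace_adj _ h) // h4 mulN1r.
  rewrite linearZ /= detE -trE.
  have -> : \tr (H ^t Num.conj)%sesqui = (\tr H)^*.
    by rewrite /mxtrace rmorph_sum; apply: eq_bigr => k _; rewrite !mxE.
  by move/eqP; rewrite mulNr eqr_opp => /eqP.
- rewrite trE => t0; rewrite t0 mulr0 add0r.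
  by rewrite (core_minors_trace0 _ _ h_gt0) // h4.
Qed.

Theorem theorem1 (R : realType) (A B : 'M[R[i]]_4)
  (hA : hadamard A) (dA : dephased A)
  (hB : hadamard B) (dB : dephased B)
  (trAB : \tr A = \tr B) :
  spectrally_equivalent A B.
Proof.
have [D [cA dAT d0A]] := hadamard_char_poly _ _ hA dA.
have [E [cB dBT d0B]] := hadamard_char_poly _ _ hB dB.
suff DE : D = E by move=> z; rewrite /spectrum_mult cA cB trAB DE.
have [t0|t_neq0] := eqVneq (\tr A) 0; first by rewrite d0A // d0B // -trAB.
(* Both [D] and [E] times the nonzero conjugate trace equal the common trace. *)
apply: (@mulIf _ (\tr A)^*); first by rewrite conjC_eq0.
by rewrite dAT {2}trAB dBT.
Qed.
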